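(* Let $\Bbbk$ be a field of characteristic $0$, let $d\ge2$, and let $\Delta$ be a $(d-1)$-dimensional pseudomanifold without boundary, on $n$ vertices, such that the dual graph of $\Delta$ is bipartite. Let $R=A(\Delta)=\Bbbk[x_1,\ldots,x_n]/\langle x_1^2,\ldots,x_n^2,I_\Delta\rangle$, where $I_\Delta$ is the Stanley-Reisner ideal of $\Delta$. Then the idealization $\tilde R=R\ltimes\omega(-d-1)$ of $R$, where $\omega$ is the graded canonical module of $R$, is an Artinian Gorenstein ring that fails the Weak Lefschetz Property (WLP) in degree $d-1$.
   Context: A simplicial complex $\Delta$ on a finite non-empty vertex set $V=\{1,\ldots,n\}$ is a non-empty collection of subsets (faces) of $V$ closed under taking subsets; a face with $k+1$ elements is a $k$-simplex; facets are the inclusion-maximal faces. The Stanley-Reisner ideal is $I_\Delta=\langle x_{i_1}\cdots x_{i_m} : \{i_1,\ldots,i_m\}\notin\Delta\rangle$. For $e\ge1$, an $e$-dimensional pseudomanifold is a simplicial complex such that: each facet is an $e$-simplex; every $(e-1)$-simplex is a face of at least one and at most two $e$-simplices; and given any two $e$-simplices $F_1,F_k$ there is a chain of $e$-simplices $F_1,F_2,\ldots,F_k$ such that $F_i\cap F_{i+1}$ is an $(e-1)$-simplex for $1\le i\le k-1$. It is without boundary if no $(e-1)$-simplex is a face of exactly one $e$-simplex. The dual graph is the graph whose vertices are the facets, two being adjacent if and only if they share an $(e-1)$-face. The ring $R=A(\Delta)$ is a standard graded Artinian $\Bbbk$-algebra which is level of socle degree $d$ (its socle equals $R_d$). Its graded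 canonical module is $\omega=\operatorname{Hom}_\Bbbk(R,\Bbbk)$, graded by $\omega_{-j}=\operatorname{Hom}_\Bbbk(R_j,\Bbbk)$, and $\omega(-d-1)_i=\omega_{i-d-1}$. The Nagata idealization $\tilde R=R\ltimes\omega(-d-1)$ is the graded $\Bbbk$-vector space $R\oplus\omega(-d-1)$ with multiplication $(r,u)(s,v)=(rs,\,rv+su)$; it is a standard graded Artinian algebra. WLP holds for a standard graded Artinian algebra $B$ in degree $i$ if, for a general linear form $\ell\in B_1$, the multiplication map $\times\ell: B_i\to B_{i+1}$ is injective or surjective; otherwise $B$ fails WLP in degree $i$. *)

(* Defs.v *)
From HB Require Import structures.
From mathcomp Require Import boolp functions.
From mathcomp Require Import all_boot all_order all_algebra ring_quotient.
From mathcomp Require Import mpoly.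

Set Implicit Arguments.
Unset Strict Implicit.
Unset Printing Implicit Defensive.

Import GRing.Theory.
Local Open Scope ring_scope.
Local Open Scope quotient_scope.

(* Vertices are 'I_n; singletons need not be faces. *)
Record complex (n : nat) := Complex {
  faces :> {set {set 'I_n}};
  faces_neq0 : faces != set0;
  faces_sub : forall F G : {set 'I_n}, F \in faces -> G \subset F -> G \in faces
}.

Section Complexes.
Variables (n : nat) (D : complex n).
Implicit Types F G H : {set 'I_n}.

Definition simplex (k : nat) F : bool := (F \in D) && (#|F| == k.+1).

Definition facet F : bool :=
  (F \in D) && [forall G in D, (F \subset G) ==> (G == F)].

Definition cofaces (e : nat) H : {set {set 'I_n}} :=
  [set F | simplex e F & H \subset F].

Definition adjacent (e : nat) F G : bool :=
  [&& simplex e F, simplex e G & simplex e.-1 (F :&: G)].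

Definition pseudomanifold (e : nat) : Prop :=
  [/\ (0 < e)%N,
      forall F, facet F -> simplex e F,
      forall H, simplex e.-1 H -> (1 <= #|cofaces e H| <= 2)%N
    & forall F G, simplex e F -> simplex e G ->
        exists2 s : seq {set 'I_n}, path (adjacent e) F s & last F s = G].

Definition without_boundary (e : nat) : Prop :=
  forall H, simplex e.-1 H -> #|cofaces e H| <> 1%N.

Definition dual_graph (e : nat) : rel {set 'I_n} := fun F G =>
  [&& facet F, facet G, F != G &
      [exists H, [&& simplex e.-1 H, H \subset F & H \subset G]]].

End Complexes.

Definition bipartite (T : finType) (V : pred T) (adj : rel T) : Prop :=
  exists c : T -> bool, forall x y, V x -> V y -> adj x y -> c x != c y.

Definition ideal_gen (R : comNzRingType) (S : R -> Prop) (x : R) : Prop :=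
  exists (m : nat) (a g : 'I_m -> R),
    (forall i, S (g i)) /\ x = \sum_(i < m) a i * g i.

Section SquarefreeAlgebra.
Variables (K : fieldType) (n : nat) (D : complex n).
Local Notation P := {mpoly K[n]}.

Definition SR_ideal : P -> Prop :=
  ideal_gen (fun p => exists2 F : {set 'I_n}, F \notin D & p = \prod_(i in F) 'X_i).

Definition A_ideal : P -> Prop :=
  ideal_gen (fun p => (exists i : 'I_n, p = 'X_i ^+ 2) \/ SR_ideal p).

Definition A_ideal_pred : P -> bool := fun p => `[< A_ideal p >].

Lemma set0_face : set0 \in D.
Proof.
by have /set0Pn[F FD] := faces_neq0 D; apply: (faces_sub FD); apply: sub0set.
Qed.

Lemma SR_ideal_eval0 p : SR_ideal p -> p.@[fun=> 0] = 0.
Proof.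
case=> m [a [g [Sg ->]]]; rewrite rmorph_sum big1 // => i _.
rewrite rmorphM /=; case: (Sg i) => F FD ->.
have /set0Pn[j jF] : F != set0 by apply: contraNneq FD => ->; apply: set0_face.
by rewrite (bigD1 j) //= rmorphM /= mevalXU mul0r mulr0.
Qed.

Lemma A_ideal_eval0 p : A_ideal p -> p.@[fun=> 0] = 0.
Proof.
case=> m [a [g [Sg ->]]]; rewrite rmorph_sum big1 // => i _.
rewrite rmorphM /=; case: (Sg i) => [[j ->]|/SR_ideal_eval0->]; last first.
  by rewrite mulr0.
by rewrite rmorphXn /= mevalXU expr0n mulr0.
Qed.

Lemma A_ideal_closed : idealr_closed A_ideal_pred.
Proof.
split.
- apply/asboolP; exists 0%N, (fun=> 0), (fun=> 0).
  by split; [case|rewrite big_ord0].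
- apply/asboolP => /A_ideal_eval0; rewrite rmorph1; apply/eqP.
  exact: oner_neq0.
move=> b x y /asboolP[m1 [a1 [g1 [S1 ->]]]] /asboolP[m2 [a2 [g2 [S2 ->]]]].
apply/asboolP; exists (m1 + m2)%N.
exists (fun i => match split i with inl j => b * a1 j | inr j => a2 j end).
exists (fun i => match split i with inl j => g1 j | inr j => g2 j end).
split=> [i|]; first by case: (split i).
rewrite big_split_ord mulr_sumr /=; congr (_ + _); apply: eq_bigr => i _.
  by case: split (unsplitK (inl i : 'I_m1 + 'I_m2)) => j //= [->]; rewrite mulrA.
by case: split (unsplitK (inr i : 'I_m1 + 'I_m2)) => j //= [->].
Qed.

HB.instance Definition _ := isIdealr.Build P A_ideal_pred A_ideal_closed.

Definition A_alg : Type := {ideal_quot (A_ideal_pred : idealr P)}.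

HB.instance Definition _ := GRing.ComNzRing.on A_alg.

Definition A_proj : P -> A_alg := \pi_{ideal_quot (A_ideal_pred : idealr P)}.

Lemma A_projD : {morph A_proj : x y / x + y}. Proof. exact: rmorphD. Qed.
Lemma A_projM : {morph A_proj : x y / x * y}. Proof. exact: rmorphM. Qed.
Lemma A_proj1 : A_proj 1 = 1. Proof. exact: rmorph1. Qed.

Definition A_scale (c : K) (x : A_alg) : A_alg := A_proj c%:MP * x.

Lemma A_scaleA a b x : A_scale a (A_scale b x) = A_scale (a * b) x.
Proof. by rewrite /A_scale mulrA -A_projM -mpolyCM. Qed.
Lemma A_scale1 : left_id 1 A_scale.
Proof. by move=> x; rewrite /A_scale mpolyC1 A_proj1 mul1r. Qed.
Lemma A_scaleDr : right_distributive A_scale +%R.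
Proof. by move=> c x y; rewrite /A_scale mulrDr. Qed.
Lemma A_scaleDl x : {morph A_scale^~ x : a b / a + b}.
Proof. by move=> a b; rewrite /A_scale mpolyCD A_projD mulrDl. Qed.

HB.instance Definition _ :=
  GRing.Zmodule_isLmodule.Build K A_alg A_scaleA A_scale1 A_scaleDr A_scaleDl.

Lemma A_scaleAl (c : K) (x y : A_alg) : c *: (x * y) = (c *: x) * y.
Proof. exact: mulrA. Qed.

HB.instance Definition _ := GRing.Lmodule_isLalgebra.Build K A_alg A_scaleAl.

Lemma A_scaleAr (c : K) (x y : A_alg) : c *: (x * y) = x * (c *: y).
Proof. by rewrite mulrC A_scaleAl mulrC. Qed.

HB.instance Definition _ := GRing.Lalgebra_isAlgebra.Build K A_alg A_scaleAr.

Definition A_deg (j : nat) (x : A_alg) : Prop :=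
  exists2 p : P, p \is j.-homog & x = A_proj p.

End SquarefreeAlgebra.

Record dual (K : fieldType) (V : lmodType K) := Dual {
  dual_fun :> V -> K;
  dual_scalar : `[< scalar dual_fun >]
}.

Section Dual.
Variables (K : fieldType) (V : lmodType K).

HB.instance Definition _ := [isSub of dual V for @dual_fun K V].
HB.instance Definition _ := [Choice of dual V by <:].

Lemma dual_ext (f g : dual V) : f =1 g -> f = g.
Proof. by move=> /funext fg; apply: val_inj. Qed.

Lemma dual_linear (f : dual V) : scalar f.
Proof. exact/asboolP/dual_scalar. Qed.

Lemma dual0_subproof : `[< scalar (fun _ : V => 0 : K) >].
Proof. by apply/asboolP => a u v; rewrite mulr0 addr0. Qed.
Lemma dualN_subproof (f : dual V) : `[< scalar (fun x => - f x) >].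
Proof. by apply/asboolP => a u v; rewrite dual_linear opprD mulrN. Qed.
Lemma dualD_subproof (f g : dual V) : `[< scalar (fun x => f x + g x) >].
Proof. by apply/asboolP => a u v; rewrite !dual_linear mulrDr addrACA. Qed.

Definition dual0 := Dual dual0_subproof.
Definition dualN f := Dual (dualN_subproof f).
Definition dualD f g := Dual (dualD_subproof f g).

Lemma dualDA : associative dualD.
Proof. by move=> f g h; apply: dual_ext => x /=; rewrite addrA. Qed.
Lemma dualDC : commutative dualD.
Proof. by move=> f g; apply: dual_ext => x /=; rewrite addrC. Qed.
Lemma dual0D : left_id dual0 dualD.
Proof. by move=> f; apply: dual_ext => x /=; rewrite add0r. Qed.
Lemma dualND : left_inverse dual0 dualN dualD.
Proof. by move=> f; apply: dual_ext => x /=; rewrite addNr. Qed.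

HB.instance Definition _ :=
  GRing.isZmodule.Build (dual V) dualDA dualDC dual0D dualND.

End Dual.

(* The R-module structure on Hom_K(R, K): (r *: f) x = f (r * x). *)
Section DualModule.
Variables (K : fieldType) (R : comAlgType K).

Lemma dualZ_subproof (r : R) (f : dual R) : `[< scalar (fun x => f (r * x)) >].
Proof. by apply/asboolP => a u v; rewrite mulrDr -scalerAr dual_linear. Qed.

Definition dualZ (r : R) (f : dual R) : dual R := Dual (dualZ_subproof r f).

Lemma dualZA r s f : dualZ r (dualZ s f) = dualZ (r * s) f.
Proof. by apply: dual_ext => x /=; rewrite mulrA [s * r]mulrC. Qed.
Lemma dualZ1 : left_id 1 dualZ.
Proof. by move=> f; apply: dual_ext => x /=; rewrite mul1r. Qed.
Lemma dualZDr : right_distributive dualZ +%R.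
Proof. by move=> r f g; apply: dual_ext. Qed.
Lemma dualZDl f : {morph dualZ^~ f : r s / r + s}.
Proof.
move=> r s; apply: dual_ext => x /=; rewrite mulrDl.
by have := dual_linear f 1 (r * x) (s * x); rewrite scale1r mul1r.
Qed.

HB.instance Definition _ :=
  GRing.Zmodule_isLmodule.Build R (dual R) dualZA dualZ1 dualZDr dualZDl.

End DualModule.

Definition idealization (R : comNzRingType) (M : lmodType R) : Type := (R * M)%type.

Section IdealizationRing.
Variables (R : comNzRingType) (M : lmodType R).
Local Notation A := (idealization M).

HB.instance Definition _ := GRing.Zmodule.copy A (R * M)%type.

Definition idealization_one : A := (1, 0).
Definition idealization_mul (x y : A) : A :=
  (x.1 * y.1, x.1 *: y.2 + y.1 *: x.2).

Lemma idealization_mulA : associative idealization_mul.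
Proof.
move=> [r u] [s v] [t w]; congr pair; rewrite /= ?mulrA //.
by rewrite !scalerDr !scalerA addrA [t * r]mulrC [t * s]mulrC.
Qed.
Lemma idealization_mulC : commutative idealization_mul.
Proof. by move=> [r u] [s v]; congr pair; rewrite /= 1?mulrC 1?addrC. Qed.
Lemma idealization_mul1 : left_id idealization_one idealization_mul.
Proof.
by move=> [r u]; congr pair; rewrite /= ?mul1r // scale1r scaler0 addr0.
Qed.
Lemma idealization_mulDl : left_distributive idealization_mul +%R.
Proof.
move=> [r u] [s v] [t w]; congr pair; rewrite /= ?mulrDl //.
by rewrite scalerDl scalerDr addrACA.
Qed.
Lemma idealization_one_neq0 : idealization_one != 0.
Proof. by apply/eqP => -[/eqP]; rewrite oner_eq0. Qed.

HB.instance Definition _ := GRing.Zmodule_isComNzRing.Build A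
  idealization_mulA idealization_mulC idealization_mul1 idealization_mulDl
  idealization_one_neq0.

End IdealizationRing.

Section IdealizationAlgebra.
Variables (K : fieldType) (R : comAlgType K) (M : lmodType R).
Local Notation A := (idealization M).

Definition idealization_scale (c : K) (x : A) : A := (c *: x.1, c%:A *: x.2).

Lemma idealization_scaleA a b x :
  idealization_scale a (idealization_scale b x) = idealization_scale (a * b) x.
Proof.
congr pair; rewrite /= scalerA //; congr (_ *: _).
by rewrite -scalerAl mul1r scalerA.
Qed.
Lemma idealization_scale1 : left_id 1 idealization_scale.
Proof. by move=> [r u]; congr pair; rewrite /= !scale1r. Qed.
Lemma idealization_scaleDr : right_distributive idealization_scale +%R.
Proof. by move=> c [r u] [s v]; congr pair; rewrite /= scalerDr. Qed.
Lemma idealization_scaleDl x :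
  {morph idealization_scale^~ x : a b / a + b}.
Proof. by move=> a b; congr pair; rewrite /= !scalerDl. Qed.

HB.instance Definition _ := GRing.Zmodule_isLmodule.Build K A
  idealization_scaleA idealization_scale1 idealization_scaleDr
  idealization_scaleDl.

Lemma idealization_scaleAl (c : K) (x y : A) : c *: (x * y) = (c *: x) * y.
Proof.
congr pair; rewrite /= ?scalerAl // scalerDr !scalerA.
by rewrite -scalerAl mul1r [_ * y.1]mulrC.
Qed.

HB.instance Definition _ := GRing.Lmodule_isLalgebra.Build K A idealization_scaleAl.

Lemma idealization_scaleAr (c : K) (x y : A) : c *: (x * y) = x * (c *: y).
Proof. by rewrite mulrC idealization_scaleAl mulrC. Qed.

HB.instance Definition _ := GRing.Lalgebra_isAlgebra.Build K A idealization_scaleAr.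

End IdealizationAlgebra.

(* A grading is given by its homogeneous components, as predicates. *)

(* Hom_K(R_j, K) sits in Hom_K(R, K) as the functionals vanishing on every
   other component; it has degree -j. *)
Definition dual_deg (K : fieldType) (R : comAlgType K) (gr : nat -> R -> Prop)
    (z : int) (f : dual R) : Prop :=
  forall (j : nat) (x : R), z != - j%:Z -> gr j x -> f x = 0.

(* M(a)_i = M_(i + a) *)
Definition shift_deg (M : Type) (gr : int -> M -> Prop) (a : int) : int -> M -> Prop :=
  fun i => gr (i + a).

Definition idealization_deg (R : comNzRingType) (M : lmodType R)
    (grR : nat -> R -> Prop) (grM : int -> M -> Prop)
    (i : nat) (x : idealization M) : Prop :=
  grR i x.1 /\ grM i%:Z x.2.

Section CommutativeRings.
Variable R : comNzRingType.

Definition is_ideal (I : R -> Prop) : Prop :=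
  [/\ I 0, forall x y, I x -> I y -> I (x + y) & forall a x, I x -> I (a * x)].

Definition artinian : Prop :=
  forall I : nat -> R -> Prop,
    (forall k, is_ideal (I k)) -> (forall k x, I k.+1 x -> I k x) ->
    exists N, forall k x, (N <= k)%N -> I N x -> I k x.

Definition nonunit (x : R) : Prop := forall y, x * y <> 1.

Definition local_ring : Prop := is_ideal nonunit.

(* (0 : m), m the maximal ideal of the local ring R *)
Definition socle (x : R) : Prop := forall m, nonunit m -> m * x = 0.

(* An Artinian local ring is Gorenstein when its socle has dimension one over
   the residue field R/m. As m kills the socle, R/m-multiples are R-multiples. *)
Definition artinian_gorenstein : Prop :=
  [/\ artinian, local_ring
    & exists s, [/\ socle s, s <> 0 & forall t, socle t -> exists a, t = a * s]].

End CommutativeRings.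

Section Zariski.
Variables (K : fieldType) (V : lmodType K) (W : V -> Prop).

(* Polynomials in linear functionals, to avoid choosing coordinates. *)
Definition polynomial_fun (f : V -> K) : Prop :=
  exists (m : nat) (l : 'I_m -> dual V) (p : {mpoly K[m]}),
    forall v, f v = p.@[fun i => l i v].

(* U is Zariski open in the subspace W: its complement in W is the common zero
   locus of a set S of polynomial functions. *)
Definition zariski_open (U : V -> Prop) : Prop :=
  exists S : (V -> K) -> Prop,
    (forall f, S f -> polynomial_fun f) /\
    (forall v, W v -> (U v <-> exists2 f, S f & f v <> 0)).

(* Q holds for a general element of W. *)
Definition general (Q : V -> Prop) : Prop :=
  exists U : V -> Prop,
    [/\ zariski_open U, exists2 v, W v & U v & forall v, W v -> U v -> Q v].

End Zariski.

Section WLP.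
Variables (K : fieldType) (B : comAlgType K) (gr : nat -> B -> Prop).

Definition mul_injective (i : nat) (l : B) : Prop :=
  forall x y, gr i x -> gr i y -> l * x = l * y -> x = y.

Definition mul_surjective (i : nat) (l : B) : Prop :=
  forall y, gr i.+1 y -> exists2 x, gr i x & l * x = y.

Definition WLP_in_degree (i : nat) : Prop :=
  general (gr 1) (fun l => mul_injective i l \/ mul_surjective i l).

End WLP.

Section NagataIdealization.
Variables (K : fieldType) (n : nat) (D : complex n).

Definition omega : Type := dual (A_alg K D).
HB.instance Definition _ := GRing.Lmodule.on omega.

Definition omega_deg : int -> omega -> Prop := dual_deg (@A_deg K n D).

Definition A_tilde : Type := idealization omega.
HB.instance Definition _ := GRing.ComAlgebra.on A_tilde.

(* The shift omega(-d-1) affects only the grading, not the ring. *)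
Definition A_tilde_deg (d : nat) : nat -> A_tilde -> Prop :=
  idealization_deg (@A_deg K n D) (shift_deg omega_deg (- d.+1%:Z)).

End NagataIdealization.

(* Main.v *)
(* The squarefree monomials x_F, F a face, form a K-basis of R. In particular R
   is finite dimensional and local, and (0, eps), with eps the constant
   coefficient, spans the socle of the idealization: an element (r, u) killed by
   all (0, v) has r = 0, and then u kills the maximal ideal of R.

   Failure of the WLP holds for every linear form l = (x, f), general or not.
   Weight each facet F by the sign of its color divided by the product of the
   coefficients x_i, i in F. The two facets through a ridge have opposite colors,
   so these weights define a nonzero functional g on R_d with x g = 0. Then x R
   misses some x_F in R_d, so l is not surjective from degree d - 1 to d; and for
   a suitable monomial z of degree d - 2 the functional z g on R_2 is nonzero
   while l (0, z g) = (0, z x g) = 0, so l is not injective. *)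
From HB Require Import structures.
Require Import Defs.
From mathcomp Require Import all_boot all_order all_algebra.
From mathcomp Require Import boolp ring_quotient mpoly.
Import GRing.Theory.
Local Open Scope ring_scope.

Lemma exprD_nilp (R : comNzRingType) (x y : R) k l :
  x ^+ k = 0 -> y ^+ l = 0 -> (x + y) ^+ (k + l) = 0.
Proof.
move=> xk yl; rewrite exprDn big1 // => i _.
case: (leqP l i) => [li|il].
  by rewrite -(subnK li) exprD yl !mulr0 mul0rn.
have ki : (k <= k + l - i)%N by rewrite -addnBA ?leq_addr // ltnW.
by rewrite -(subnK ki) exprD xk mulr0 mul0r mul0rn.
Qed.

(** * The face monomials as a basis of [R]; units and nilpotents of [R] *)

Section FaceBasis.
Context {K : fieldType} {n : nat} {D : complex n}.
Local Notation R := (A_alg K D).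
Local Notation P := {mpoly K[n]}.
Local Notation proj := (@A_proj K n D).
Implicit Types (F G H : {set 'I_n}) (p q : P) (x y : R).

Lemma A_proj_surj x : exists p, x = proj p.
Proof. by exists (repr x); rewrite /A_proj reprK. Qed.

Lemma A_proj_eq p q : proj p = proj q <-> A_ideal D (p - q).
Proof.
split=> [/eqP|I]; rewrite /A_proj.
  by rewrite eqmodE /= => /asboolP.
by apply/eqP; rewrite eqmodE /=; apply/asboolP.
Qed.

Lemma A_proj_eq0 p : proj p = 0 <-> A_ideal D p.
Proof.
have e0 : proj 0 = 0 by exact: rmorph0.
by rewrite -e0 A_proj_eq subr0.
Qed.

Lemma A_projZ c p : proj (c *: p) = c *: proj p.
Proof. by rewrite -mul_mpolyC A_projM. Qed.

Lemma A_proj_sum I (r : seq I) (E : I -> P) :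
  proj (\sum_(i <- r) E i) = \sum_(i <- r) proj (E i).
Proof. by apply: big_morph; [exact: A_projD | exact: rmorph0]. Qed.

Definition face_monomial F : R := proj 'X_[mesym1 F].
Local Notation x_ := face_monomial.

Lemma A_gen0 p : (exists i : 'I_n, p = 'X_i ^+ 2) \/ SR_ideal D p -> proj p = 0.
Proof.
move=> pI; apply/A_proj_eq0; exists 1%N, (fun=> 1), (fun=> p).
by rewrite big_ord1 mul1r.
Qed.

Lemma mpolyX_mesym1 F : 'X_[mesym1 F] = \prod_(i in F) 'X_i :> P.
Proof.
rewrite mpolyXE_id [RHS]big_mkcond; apply: eq_bigr => i _.
by rewrite mnmE; case: (i \in F).
Qed.

Lemma face_monomial0 F : F \notin D -> x_ F = 0.
Proof.
move=> FD; apply: A_gen0; right; exists 1%N, (fun=> 1), (fun=> 'X_[mesym1 F]).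
rewrite big_ord1 mul1r; split=> // _; exists F => //.
exact: mpolyX_mesym1.
Qed.

Lemma A_proj_nsqfree (m : 'X_{1..n}) i : (1 < m i)%N -> proj 'X_[m] = 0.
Proof.
move=> mi; have -> : m = (m - U_(i) *+ 2 + U_(i) *+ 2)%MM.
  rewrite submK //; apply/mnm_lepP => j; rewrite mulmnE mnmE.
  by case: eqP => [<-|].
by rewrite mpolyXD -mpolyXn A_projM [proj ('X_i ^+ 2)]A_gen0 ?mulr0 //; left; exists i.
Qed.

Lemma A_projX (m : 'X_{1..n}) :
  (exists2 F, F \in D & m = mesym1 F) \/ proj 'X_[m] = 0.
Proof.
case: (boolP [exists i, (1 < m i)%N]) => [/existsP[i mi]|/existsPn sqf].
  by right; apply: A_proj_nsqfree mi.
have mE : m = mesym1 [set i | m i != 0%N].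
  apply/mnmP => i; rewrite mnmE inE; have := sqf i.
  by case: (m i) => [|[|]].
case: (boolP ([set i | m i != 0%N] \in D)) => [FD|FD].
  by left; eexists; [exact: FD|].
by right; rewrite mE; apply: face_monomial0.
Qed.

Lemma face_monomialM F G :
  x_ F * x_ G = if [disjoint F & G] then x_ (F :|: G) else 0.
Proof.
rewrite /x_ -A_projM -mpolyXD; case: ifPn => [dFG|].
  congr (proj 'X_[_]); apply/mnmP => i; rewrite mnmDE !mnmE inE.
  by case: (boolP (i \in F)) => //= iF; rewrite (disjointFr dFG iF).
rewrite -setI_eq0 => /set0Pn[i]; rewrite inE => /andP[iF iG].
by apply: (@A_proj_nsqfree _ i); rewrite mnmDE !mnmE iF iG.
Qed.

Lemma mesym1_inj : injective (@mesym1 n).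
Proof.
move=> F G /mnmP e; apply/setP => i; move: (e i); rewrite !mnmE.
by case: (i \in F); case: (i \in G).
Qed.

(* For F in D the choice of [repr x] is immaterial, by [coord_proj]. *)
Definition coord F x : K := if F \in D then (repr x)@_(mesym1 F) else 0.

(** The ideal is generated by squares and non-face monomials. A square divides no squarefree
    monomial, and a non-face is not contained in a face. Hence the face monomials are linearly
    independent. *)
Lemma mcoeff_A_ideal F p : F \in D -> A_ideal D p -> p@_(mesym1 F) = 0.
Proof.
move=> FD; have nF (q : P) (m : 'X_{1..n}) : ~~ (m <= mesym1 F)%MM ->
    (q * 'X_[m])@_(mesym1 F) = 0.
  move=> mF; apply/eqP; rewrite mcoeff_eq0; apply/negP.
  rewrite (perm_mem (msuppMX q m)) => /mapP[m' _ e]; case/negP: mF.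
  by rewrite e lem_addr.
case=> k [a [g [Sg ->]]]; rewrite raddf_sum big1 //= => i _.
case: (Sg i) => [[j ->]|[l [b [h [Sh ->]]]]].
  rewrite mpolyXn nF //; apply/negP => /mnm_lepP/(_ j).
  by rewrite mulmnE !mnmE eqxx; case: (j \in F).
rewrite mulr_sumr raddf_sum big1 //= => j _; case: (Sh j) => G GD ->.
rewrite -mpolyX_mesym1 mulrA nF //; apply: contra GD => /mnm_lepP le.
apply: faces_sub FD _; apply/subsetP => v vG; move: (le v).
by rewrite !mnmE vG; case: (v \in F).
Qed.

Lemma coord_proj F p : coord F (proj p) = if F \in D then p@_(mesym1 F) else 0.
Proof.
rewrite /coord; case: ifP => // FD.
have /A_proj_eq/(mcoeff_A_ideal _ _ FD)/eqP : proj (repr (proj p)) = proj p.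
  by rewrite /A_proj reprK.
by rewrite mcoeffB subr_eq0 => /eqP.
Qed.

Lemma coord_scalar F : scalar (coord F).
Proof.
move=> c x y; have [p ->] := A_proj_surj x; have [q ->] := A_proj_surj y.
rewrite -A_projZ -A_projD !coord_proj; case: ifP => _; last by rewrite mulr0 addr0.
by rewrite mcoeffD mcoeffZ.
Qed.

HB.instance Definition _ F :=
  GRing.isLinear.Build K R K *%R (coord F) (coord_scalar F).

Lemma coord_face F G : F \in D -> coord F (x_ G) = (F == G)%:R.
Proof.
by move=> FD; rewrite coord_proj FD mcoeffX (inj_eq mesym1_inj) eq_sym.
Qed.

(** Both sides are linear in [x], so it suffices to treat monomials, each of which is a face
    monomial or zero in [R]. *)
Lemma face_expansion x : x = \sum_(F in D) coord F x *: x_ F.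
Proof.
have [p ->] := A_proj_surj x; rewrite {x}[p]mpolyE A_proj_sum.
under [RHS]eq_bigr do rewrite linear_sum scaler_suml.
rewrite [RHS]exchange_big /=; apply: eq_bigr => m _.
rewrite A_projZ; under eq_bigr do rewrite linearZ -scalerA.
rewrite -scaler_sumr; congr (_ *: _); case: (A_projX m) => [[G GD ->]|->].
  rewrite (bigD1 G) //= coord_face // eqxx scale1r big1 ?addr0 // => F /andP[FD FG].
  by rewrite coord_face // (negPf FG) scale0r.
by rewrite big1 // => F _; rewrite linear0 scale0r.
Qed.

Lemma coord_inj x y : (forall F, F \in D -> coord F x = coord F y) -> x = y.
Proof.
move=> xy; rewrite [x]face_expansion [y]face_expansion.
by apply: eq_bigr => F /xy ->.
Qed.

Lemma A_deg_coord j x F : A_deg j x -> #|F| <> j -> coord F x = 0.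
Proof.
case=> p hp -> Fj; rewrite coord_proj; case: ifP => // _.
apply: (dhomog_nemf_coeff hp); rewrite /= mdeg_mesym1; exact/eqP.
Qed.

Lemma A_deg_face F : A_deg #|F| (x_ F).
Proof. by exists 'X_[mesym1 F] => //; rewrite dhomogX /= mdeg_mesym1. Qed.

Lemma A_degM i j x y : A_deg i x -> A_deg j y -> A_deg (i + j) (x * y).
Proof.
case=> p hp ->; case=> q hq ->; exists (p * q); first exact: dhomogM.
by rewrite A_projM.
Qed.

Lemma face_monomial_set0 : x_ set0 = 1.
Proof. by rewrite /x_ mesym1_set0 mpolyX0; exact: A_proj1. Qed.

(** [coord set0] reads off the constant coefficient, which is multiplicative on polynomials. *)
Lemma coord_set0M x y : coord set0 (x * y) = coord set0 x * coord set0 y.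
Proof.
have [p ->] := A_proj_surj x; have [q ->] := A_proj_surj y.
by rewrite -A_projM !coord_proj set0_face mesym1_set0 rmorphM.
Qed.

Lemma coord_set0_1 : coord set0 1 = 1.
Proof. by rewrite -face_monomial_set0 coord_face ?set0_face ?eqxx. Qed.

(** Only nonempty faces contribute to [x]; their monomials square to zero, and nilpotents are closed
    under sums. *)
Lemma coord_set0_nilp x : coord set0 x = 0 -> exists k, x ^+ k = 0.
Proof.
move=> x0; rewrite [x]face_expansion.
apply: (big_ind (fun y => exists k, y ^+ k = 0)) => [|y z [k yk] [l zl]|F FD].
- by exists 1%N; rewrite expr1.
- by exists (k + l)%N; apply: exprD_nilp.
exists 2; case: (eqVneq F set0) => [->|F0]; first by rewrite x0 scale0r expr0n.
rewrite expr2 -scalerAl -scalerAr face_monomialM -setI_eq0 setIid (negPf F0).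
by rewrite !scaler0.
Qed.

(** After scaling, [x] is [1 - z] with [z] nilpotent, and a finite geometric series inverts it. *)
Lemma coord_set0_unit x : coord set0 x != 0 -> exists y, x * y = 1.
Proof.
set c := coord set0 x => c0; pose z := 1 - c^-1 *: x.
have [|k zk] := @coord_set0_nilp z.
  by rewrite /z raddfB /= coord_set0_1 linearZ /= -/c mulVf ?subrr.
exists (c^-1 *: \sum_(i < k) z ^+ i); rewrite -scalerAr scalerAl.
have -> : c^-1 *: x = 1 - z by rewrite /z opprB addrC subrK.
by rewrite -(opprB z) mulNr -subrX1 zk sub0r opprK.
Qed.

End FaceBasis.

HB.instance Definition _ (K : fieldType) (V : lmodType K) (f : dual V) :=
  GRing.isLinear.Build K V K *%R (dual_fun f) (dual_linear f).

Local Notation x_ := face_monomial.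

(** * Functionals given by their values on face monomials *)

Section Functionals.
Context {K : fieldType} {n : nat} {D : complex n}.
Local Notation R := (A_alg K D).
Implicit Types (F G H : {set 'I_n}) (x y : R) (f g : omega K D).

Lemma face_dual_subproof (w : {set 'I_n} -> K) :
  `[< scalar (fun x : R => \sum_(F in D) w F * coord F x) >].
Proof.
apply/asboolP => c x y; rewrite mulr_sumr -big_split; apply: eq_bigr => F _ /=.
by rewrite linearP mulrDr mulrCA.
Qed.

Definition face_dual (w : {set 'I_n} -> K) : omega K D := Dual (face_dual_subproof w).

Lemma face_dual_face w G : G \in D -> face_dual w (x_ G) = w G.
Proof.
move=> GD; rewrite /= (bigD1 G) //= coord_face // eqxx mulr1 big1 ?addr0 //.
by move=> F /andP[FD FG]; rewrite coord_face // (negPf FG) mulr0.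
Qed.

Lemma dual_face_ext f g : (forall F, F \in D -> f (x_ F) = g (x_ F)) -> f = g.
Proof.
move=> fg; apply: dual_ext => x; rewrite [x]face_expansion !linear_sum.
by apply: eq_bigr => F FD; rewrite !linearZ /= fg.
Qed.

End Functionals.

(** * Descending chains in finite-dimensional spaces *)

Lemma vspace_of_subspace (K : fieldType) (V : vectType K) (I : V -> Prop) :
  I 0 -> (forall c u v, I u -> I v -> I (c *: u + v)) ->
  exists U : {vspace V}, forall v, v \in U <-> I v.
Proof.
(* The witness is a subspace inside [I] of maximal dimension: adjoining a missing vector of [I]
   would raise it. *)
move=> I0 IP; pose ok k :=
  `[< exists2 U : {vspace V}, (forall v, v \in U -> I v) & \dim U = k >].
have ok0 : exists k, ok k.
  exists 0%N; apply/asboolP; exists 0%VS => [v|]; last exact: dimv0.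
  by rewrite memv0 => /eqP ->.
have okle k : ok k -> (k <= \dim {:V})%N.
  by move=> /asboolP[U _ <-]; rewrite dimvS ?subvf.
case: (ex_maxnP ok0 okle) => k /asboolP[U UI Uk] kmax.
exists U => v; split=> [/UI //|Iv]; apply/negPn/negP => vU.
have := kmax (\dim (U + <[v]>)%VS); have -> : ok (\dim (U + <[v]>)%VS).
  apply/asboolP; exists (U + <[v]>)%VS => // w /memv_addP[u /UI Iu [_ /vlineP[c ->] ->]].
  by rewrite addrC; apply: IP.
move/(_ isT); rewrite -Uk => le.
have /eqP e : U == (U + <[v]>)%VS by rewrite eqEdim addvSl.
by case/negP: vU; rewrite e (subvP (addvSr _ _)) // memv_line.
Qed.

(** The chain is constant from a term of minimal dimension on. *)
Lemma subspace_dcc (K : fieldType) (V : vectType K) (I : nat -> V -> Prop) :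
  (forall k, I k 0) -> (forall k c u v, I k u -> I k v -> I k (c *: u + v)) ->
  (forall k v, I k.+1 v -> I k v) ->
  exists N, forall k v, (N <= k)%N -> I N v -> I k v.
Proof.
move=> I0 IP dec.
have [U UI] := choice (fun k => vspace_of_subspace K V (I k) (I0 k) (IP k)).
pose ok j := `[< exists k, \dim (U k) = j >].
have ok_dim k : ok (\dim (U k)) by apply/asboolP; exists k.
case: (ex_minnP (ex_intro ok _ (ok_dim 0%N))) => j /asboolP[N UN] min_j.
have subI k l v : (k <= l)%N -> I l v -> I k v.
  elim: l => [|l IH]; rewrite leq_eqVlt => /orP[/eqP-> //|kl] //.
  by move=> /dec; exact: IH.
exists N => k v Nk /UI vN; apply/UI.
have /eqP -> // : U k == U N.
rewrite eqEdim UN min_j ?ok_dim // andbT.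
by apply/subvP => w /UI/(subI _ _ _ Nk) wN; apply/UI.
Qed.

(** * The idealization is Artinian, local and Gorenstein *)

Section Gorenstein.
Context {K : fieldType} {n : nat} {D : complex n}.
Local Notation R := (A_alg K D).
Local Notation At := (A_tilde K D).

Lemma A_tilde_mulE (s t : At) : s * t = (s.1 * t.1, s.1 *: t.2 + t.1 *: s.2).
Proof. by []. Qed.

Lemma dual_scaleE (r : R) (f : omega K D) x : (r *: f) x = f (r * x).
Proof. by []. Qed.

Lemma A_tilde_artinian : artinian At.
Proof.
move=> I idI dec.
pose V := {ffun {set 'I_n} + {set 'I_n} -> K^o}.
(* [phi] records both components in the face basis and its dual. It is linear and injective, so
   ideals become subspaces of a finite-dimensional space. *)
pose phi (t : At) : V := [ffun s => match s with
  | inl F => coord F t.1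
  | inr F => if F \in D then t.2 (x_ F) else 0 end].
have phiP c (s t : At) : phi (c *: s + t) = c *: phi s + phi t.
  apply/ffunP => -[F|F]; rewrite !ffunE /=; first by rewrite linearP.
  case: ifP => _; last by rewrite scaler0 addr0.
  by rewrite -scalerAl mul1r linearZ.
have phi_inj : injective phi.
  move=> [r f] [s g] /ffunP e; congr pair.
    rewrite [r]face_expansion [s]face_expansion; apply: eq_bigr => F _.
    by have := e (inl F); rewrite !ffunE => ->.
  by apply: dual_face_ext => F FD; have := e (inr F); rewrite !ffunE FD.
have phi0 : phi 0 = 0.
  by have := phiP (-1) 0 0; rewrite scaler0 addr0 scaleN1r addNr.
have [k|k c u v|k v|N HN] := @subspace_dcc K V (fun k v => exists2 t, I k t & phi t = v).
- by exists 0 => //; have [] := idI k.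
- move=> [s Is <-] [t It <-]; exists (c *: s + t) => //.
  have [_ ID IM] := idI k; apply: ID => //.
  by rewrite -mulr_algl; apply: IM.
- by case=> t It <-; exists t => //; apply: dec.
exists N => k t Nk It; have [|s Is /phi_inj <- //] := HN k (phi t) Nk.
by exists t.
Qed.

Lemma A_tilde_nonunit (t : At) : nonunit t <-> coord set0 t.1 = 0.
Proof.
split=> [nu|t0 s e]; last first.
  have /(congr1 (coord set0)) : t.1 * s.1 = 1 by have := congr1 fst e.
  by rewrite coord_set0M t0 mul0r coord_set0_1 => /esym/eqP; rewrite oner_eq0.
apply/eqP/negPn/negP => /coord_set0_unit[y ty].
(* If [r y = 1], the inverse of [(r, u)] is [(y, - y^2 u)]. *)
apply: (nu (y, - ((y * y) *: t.2))); rewrite A_tilde_mulE /= ty.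
by congr pair; rewrite scalerN scalerA mulrA ty mul1r addNr.
Qed.

Lemma A_tilde_local : local_ring At.
Proof.
split=> [|x y /A_tilde_nonunit x0 /A_tilde_nonunit y0|a x /A_tilde_nonunit x0];
  apply/A_tilde_nonunit => /=; first exact: linear0.
- by rewrite linearD /= x0 y0 addr0.
by rewrite coord_set0M x0 mulr0.
Qed.

Lemma A_tilde_gorenstein : artinian_gorenstein At.
Proof.
split; [exact: A_tilde_artinian|exact: A_tilde_local|].
pose cf F : omega K D := Dual (asboolT (@coord_scalar K n D F)).
exists (0, cf set0); split=> [m /A_tilde_nonunit m0|[e0]|t soc].
- rewrite A_tilde_mulE mulr0 scale0r addr0; congr pair; apply: dual_ext => x.
  by rewrite dual_scaleE /= coord_set0M m0 mul0r.
- have := congr1 (fun f => f 1) e0.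
  by rewrite coord_set0_1; apply/eqP/oner_neq0.
have t1 : t.1 = 0.
  rewrite [t.1]face_expansion big1 // => F FD.
  (* Multiplying by [(0, cf F)] and evaluating at [1] extracts the coordinate of [t.1] at [F]. *)
  have nu : nonunit ((0, cf F) : At) by apply/A_tilde_nonunit; exact: linear0.
  have := congr1 (fun s : At => s.2 1) (soc _ nu).
  by rewrite A_tilde_mulE scale0r add0r dual_scaleE mulr1 => /= ->; rewrite scale0r.
(* The multiplier is the value of [t.2] at the empty face; at a nonempty face [t.2] vanishes because
   [(x_ F, 0)] kills [t]. *)
exists ((t.2 1)%:A, 0); rewrite A_tilde_mulE /= mulr0 scaler0 addr0.
rewrite [t]surjective_pairing t1; congr pair; apply: dual_face_ext => F FD.
rewrite dual_scaleE /= -scalerAl mul1r linearZ /= coord_face ?set0_face // eq_sym.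
case: (eqVneq F set0) => [->|F0]; first by rewrite face_monomial_set0 mulr1.
have nu : nonunit ((x_ F, 0) : At).
  by apply/A_tilde_nonunit; rewrite /= coord_face ?set0_face // eq_sym (negPf F0).
have := congr1 (fun s : At => s.2 1) (soc _ nu).
by rewrite A_tilde_mulE [_.2]/= scaler0 addr0 dual_scaleE mulr1 mulr0 => ->.
Qed.
End Gorenstein.

(** * Facets and ridges of a pseudomanifold *)

Section Complexes.
Context {n : nat} {D : complex n}.
Implicit Types (F G H : {set 'I_n}).

Lemma face_sub_facet F : F \in D -> exists2 G, facet D G & F \subset G.
Proof.
move=> FD; have P0 : (F \in D) && (F \subset F) by rewrite FD subxx.
case: (@arg_maxnP _ F (fun G => (G \in D) && (F \subset G)) (fun G => #|G|) P0).
move=> G /andP[GD FG] Gmax; exists G => //; rewrite /facet GD.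
apply/forall_inP => E ED; apply/implyP => GE; rewrite eq_sym eqEcard GE.
by apply: Gmax; rewrite ED (subset_trans FG).
Qed.

(** By purity, a facet containing [F] has the same size as [F]. *)
Lemma simplex_facet e F :
  (forall G, facet D G -> simplex D e G) -> simplex D e F -> facet D F.
Proof.
move=> pure /andP[FD /eqP Fe]; have [G Gf FG] := face_sub_facet F FD.
have /andP[_ /eqP Ge] := pure _ Gf.
suff /eqP -> : F == G by [].
by rewrite eqEcard FG Ge Fe leqnn.
Qed.

(** The ridge [H] has exactly two cofaces, and by size each adds a single vertex to [H]. *)
Lemma two_cofaces e H : pseudomanifold D e -> without_boundary D e ->
  simplex D e.-1 H -> exists v w,
  [/\ v != w, v \notin H, w \notin H & forall i, i \notin H ->
   (i |: H \in D) = (i == v) || (i == w)].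
Proof.
case=> e0 _ ridge _ nobd Hs; have /andP[HD /eqP cH] := Hs.
have cofaceP i : i \notin H -> (i |: H \in cofaces D e H) = (i |: H \in D).
  by move=> iH; rewrite inE /simplex subsetUr cardsU1 iH cH prednK // eqxx !andbT.
have coface_ex F : F \in cofaces D e H -> exists2 i, i \notin H & F = i |: H.
  rewrite inE /simplex => /andP[/andP[FD /eqP cF] HF].
  have /cards1P[i Fi] : #|F :\: H| == 1%N.
    by rewrite cardsDS // cF cH prednK // subSnn.
  have iFH : i \in F :\: H by rewrite Fi set11.
  exists i; first by move: iFH; rewrite inE => /andP[].
  by rewrite -(setID F H) Fi (setIidPr HF) setUC.
have /cards2P[F [G [FG cof]]] : #|cofaces D e H| == 2%N.
  by have := ridge H Hs; have := nobd H Hs; case: #|_| => [|[|[|]]].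
have [v vH Fv] : exists2 i, i \notin H & F = i |: H.
  by apply: coface_ex; rewrite cof set21.
have [w wH Gw] : exists2 i, i \notin H & G = i |: H.
  by apply: coface_ex; rewrite cof set22.
have inj i j : i \notin H -> i |: H = j |: H -> i = j.
  move=> iH /setP/(_ i); rewrite !inE eqxx (negPf iH) !orbF /=.
  by move=> /esym/eqP.
exists v, w; split=> // [|i iH]; first by apply: contraNneq FG => vw; rewrite Fv Gw vw.
rewrite -cofaceP // cof !inE Fv Gw; congr (_ || _);
  apply/eqP/eqP => [|-> //]; exact: inj.
Qed.
End Complexes.

(** * A top-degree functional annihilated by a linear form *)

Section WLP.
Context {K : fieldType} {n : nat} {D : complex n}.
Local Notation R := (A_alg K D).
Implicit Types (F G H : {set 'I_n}) (x y : R) (f g : omega K D).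

(** The sum may run over all vertices, since the monomial of a vertex that is not a face
    vanishes. *)
Lemma A_deg1_expansion x : A_deg 1 x -> x = \sum_i coord [set i] x *: x_ [set i].
Proof.
move=> x1; apply: coord_inj => F FD; rewrite linear_sum /=.
under eq_bigr do rewrite linearZ /= coord_face //.
case: (boolP (#|F| == 1%N)) => [/cards1P[j ->]|/eqP F1].
  rewrite (bigD1 j) //= eqxx mulr1 big1 ?addr0 // => i ij.
  by rewrite (inj_eq set1_inj) eq_sym (negPf ij) mulr0.
rewrite (A_deg_coord _ _ _ x1) // big1 // => i _.
by case: eqP F1 => [->|]; rewrite ?cards1 ?mulr0.
Qed.

(* The coloring gives a functional on the top component of R that vanishes on
   the image of multiplication by x. *)
Lemma bipartite_annihilator d x : (2 <= d)%N ->
  pseudomanifold D d.-1 -> without_boundary D d.-1 ->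
  bipartite (facet D) (dual_graph D d.-1) -> A_deg 1 x ->
  exists g : omega K D, [/\ x *: g = 0,
    forall j y, A_deg j y -> j <> d -> g y = 0
  & exists2 F, simplex D d.-1 F & g (x_ F) != 0].
Proof.
move=> d2 pmD bdD [c bip] x1; have [_ pure _ _] := pmD.
have dK : d.-1.+1 = d by rewrite prednK // ltnW.
pose a i := coord [set i] x; pose S := [set i | a i != 0].
have [F0 F0facet _] := face_sub_facet set0 (set0_face D).
case: (@arg_maxnP _ F0 (facet D) (fun F => #|F :\: S|) F0facet) => M Mfacet Mmax.
pose T := M :\: S.
(* The usual weight is (-1)^(c F) / \prod_(i in F) a_i; to allow zero a_i, it is
   restricted to the facets with F \ S = T, where T is maximal. *)
pose w F := if (#|F| == d) && (F :\: S == T)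
  then (-1) ^+ c F / \prod_(i in F :&: S) a i else 0 : K.
have w0 F : #|F| <> d -> w F = 0 by rewrite /w => /eqP/negPf->.
have unitP F : \prod_(i in F :&: S) a i != 0.
  by apply/prodf_neq0 => i; rewrite !inE => /andP[].
have adw v u H : simplex D d.-2 H -> v != u -> v \notin H -> u \notin H ->
  v |: H \in D -> u |: H \in D -> a v * w (v |: H) + a u * w (u |: H) = 0.
  move=> Hs vu vH uH vHD uHD.
  have /andP[HD /eqP cH] := Hs.
  have cvH i : i \notin H -> #|i |: H| = d.
    by move=> iH; rewrite cardsU1 iH cH; case: (d) d2 => [|[|]].
  have fac i : i \notin H -> i |: H \in D -> facet D (i |: H).
    by move=> iH iHD; apply: simplex_facet pure _; rewrite /simplex iHD cvH // dK eqxx.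
  (* The term depends on [i] only through the color: a nonzero [a i] cancels against the product,
     while [a i = 0] with [H :\: S = T] would give a facet with more vertices outside [S] than
     [M]. *)
  have aw i : i \notin H -> i |: H \in D -> a i * w (i |: H) =
    if H :\: S == T then (-1) ^+ c (i |: H) / \prod_(j in H :&: S) a j else 0.
    move=> iH iHD; case: (eqVneq (a i) 0) => [ai0|ai0].
      rewrite ai0 mul0r; case: eqP => // HT.
      have := Mmax _ (fac i iH iHD); rewrite -/T -HT setDUl.
      have -> : [set i] :\: S = [set i].
        by apply/setP => j; rewrite !inE; case: (eqVneq j i) => [->|];
          rewrite ?ai0 ?eqxx ?andbF.
      by rewrite cardsU1 !inE negb_and iH orbT /= add1n ltnn.
    rewrite /w cvH // eqxx /= setDUl.
    have -> : [set i] :\: S = set0.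
      by apply/setP => j; rewrite !inE; case: (eqVneq j i) => [->|];
          rewrite ?ai0 ?andbF.
    rewrite set0U; case: ifP => _; last by rewrite mulr0.
    rewrite setIUl; have -> : [set i] :&: S = [set i].
      by apply/setP => j; rewrite !inE; case: (eqVneq j i) => [->|];
          rewrite ?ai0 ?andbF.
    rewrite big_setU1 /= ?inE ?negb_and ?iH // mulrCA invfM.
    by rewrite (mulrA (a i)) divff // mul1r.
  rewrite !aw //; case: ifP => _; last by rewrite addr0.
  have : c (v |: H) != c (u |: H).
    apply: bip; rewrite ?fac //; rewrite /dual_graph !fac //=.
    apply/andP; split.
      apply: contraNneq vu => /setP/(_ v); rewrite !inE eqxx (negPf vH) !orbF /=.
      by move=> /esym.
    by apply/existsP; exists H; rewrite Hs !subsetUr.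
  by case: (c _); case: (c _) => // _; rewrite -mulrDl ?addNr ?addrN mul0r.
exists (face_dual w); split.
(* At [x_ H] the value is a sum over the faces [i |: H], whose weights vanish unless [H] is a ridge,
   that is, has [d - 1] vertices. *)
- apply: dual_face_ext => H HD; rewrite dual_scaleE [RHS]/=.
  have gF F : F \in D -> (face_dual w : omega K D) (x_ F) = w F.
    by move=> FD; rewrite face_dual_face.
  move: (face_dual w) gF => g gF; rewrite (A_deg1_expansion _ x1) mulr_suml linear_sum.
  have term i : g (coord [set i] x *: x_ [set i] * x_ H) =
      if (i \notin H) && (i |: H \in D) then a i * w (i |: H) else 0.
    rewrite -scalerAl linearZ /= face_monomialM disjoints1.
    case: (i \in H) => /=; first by rewrite linear0 mulr0.
    case: ifPn => iHD; first by rewrite gF.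
    by rewrite face_monomial0 // linear0 mulr0.
  rewrite (eq_bigr _ (fun i _ => term i)).
  case: (boolP (simplex D d.-2 H)) => [Hs|Hs].
    have [v [u [vu vH uH cof]]] := two_cofaces _ _ pmD bdD Hs.
    rewrite (bigD1 v) // (bigD1 u) 1?eq_sym //= big1 => [|i /andP[iv iu]].
      by rewrite vH uH !cof // !eqxx orbT /= addr0 adw // cof // eqxx ?orbT.
    by case: ifP => // /andP[iH]; rewrite cof // (negPf iv) (negPf iu).
  rewrite big1 // => i _; case: ifP => // /andP[iH iHD].
  rewrite w0 ?mulr0 // cardsU1 iH => dH; case/negP: Hs.
  by move: d2; rewrite /simplex HD -dH; case: #|H| => [|k] //= _; rewrite eqxx.
- move=> j y yj jd; rewrite /= big1 // => F _.
  case: (eqVneq #|F| d) => [Fd|/eqP/w0->]; last by rewrite mul0r.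
  by rewrite (A_deg_coord _ _ _ yj) ?mulr0 // Fd => /esym.
have Ms := pure _ Mfacet; have /andP[MD /eqP cM] := Ms.
exists M => //; rewrite face_dual_face // /w cM dK !eqxx /= mulf_neq0 ?signr_eq0 //.
by rewrite invr_eq0.
Qed.
End WLP.

(** * Failure of injectivity and surjectivity in degree [d - 1] *)

Theorem corollary5p2 (K : fieldType) (n d : nat) (D : complex n)
    (charK : [pchar K] =i pred0) (n_gt0 : (0 < n)%N) (d_ge2 : (2 <= d)%N)
    (pmD : pseudomanifold D d.-1) (bdD : without_boundary D d.-1)
    (bipD : bipartite (facet D) (dual_graph D d.-1)) :
  artinian_gorenstein (A_tilde K D) /\
  ~ WLP_in_degree (@A_tilde_deg K n D d) d.-1.
Proof.
split; first exact: A_tilde_gorenstein.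
(* The open set has a point [l], so some linear form would be injective or surjective. *)
case=> U [_ [l l1 Ul] /(_ l l1 Ul)]; have [lA _] := l1.
have [g [ag gd [F Fs gF]]] := bipartite_annihilator _ _ d_ge2 pmD bdD bipD lA.
have dK : d.-1.+1 = d by rewrite prednK // ltnW.
have /andP[_ /eqP cF] := Fs; rewrite dK in cF.
have omega0 z : omega_deg z (0 : omega K D) by [].
case=> [inj|surj].
  (* Removing [d - 2] vertices from [F] leaves an edge [F :\: E], on whose monomial [x_ E *: g]
     takes the value [g (x_ F)]. *)
  have [E EF cE] : exists2 E : {set 'I_n}, E \subset F & #|E| = (d - 2)%N.
    have /card_gt0P[E] :
        (0 < #|[set E : {set 'I_n} | (E \subset F) && (#|E| == d - 2)%N]|)%N.
      by rewrite cards_draws bin_gt0 cF leq_subr.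
    by rewrite inE => /andP[EF /eqP cE]; exists E.
  (* (0, u) is a nonzero element of degree d - 1 killed by l. *)
  pose u : omega K D := face_monomial E *: g.
  have u0 : u != 0.
    apply: contraNneq gF => /(congr1 (fun h : omega K D => h (face_monomial (F :\: E)))).
    rewrite dual_scaleE face_monomialM -setI_eq0 setIDA setDIl setDv set0I eqxx.
    by rewrite -{1}(setIidPr EF) setID => ->.
  case/eqP: u0; apply: (congr1 snd (inj (0, u) 0 _ _ _)).
  - split; first by exists 0; [exact: dhomog0|exact/esym/rmorph0].
    (* [u] lives on [R_2], hence in degree [-2], which the shift moves to [-2 + (d + 1) = d - 1]. *)
    move=> j y jz yj; rewrite dual_scaleE.
    have /gd : A_deg (d - 2 + j) (face_monomial E * y).
      by apply: A_degM => //; rewrite -cE; exact: A_deg_face.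
    apply=> e; case/eqP: jz.
    have -> : j = 2 by apply/eqP; rewrite -(eqn_add2l (d - 2)) e subnK.
    have -> : d.+1 = (d.-1 + 2)%N by rewrite addn2 dK.
    by rewrite PoszD opprD addrA subrr add0r.
  - split; first by exists 0; [exact: dhomog0|exact/esym/rmorph0].
    exact: omega0.
  rewrite A_tilde_mulE /= mulr0 scale0r addr0 /u scalerA mulrC -scalerA ag scaler0.
  by rewrite mulr0.
(* A preimage [s] would give [g (x_ F) = (l.1 *: g) s.1 = 0]. *)
have [|s _ /(congr1 fst) /= e] := surj (face_monomial F, 0).
  split; last exact: omega0.
  by rewrite dK -cF; exact: A_deg_face.
by case/eqP: gF; rewrite -e -dual_scaleE ag.
Qed.
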